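(* Let $\mathcal G$ be a connected undirected weighted graph on $N\ge2$ vertices with Laplacian matrix $\mathcal L$, and let $\lambda_2$ and $\lambda_N$ be the smallest and the largest nonzero eigenvalues of $\mathcal L$, respectively. Consider the system with one-tap memory $$x(k+1)=((1+\theta_0)I-\alpha\mathcal L)x(k)+\theta_1x(k-1),\qquad \theta_0+\theta_1=0,$$ and the optimal convergence rate $$\gamma_1^*=\min_{\{\alpha,\theta_0,\theta_1\}}\ \max_{i\in\{1,2,N\}}\bar r(h_i(z)),$$ the minimum being over real $\alpha,\theta_0,\theta_1$ with $\theta_0+\theta_1=0$, where $$h_1(z)=z-\theta_0,\qquad h_i(z)=z^2-(1+\theta_0-\alpha\lambda_i)z-\theta_1\quad(i=2,N),$$ and $\bar r(h)$ is the maximum modulus of the roots of $h$. Then $$\gamma_1^*=\frac{\sqrt{\lambda_N/\lambda_2}-1}{\sqrt{\lambda_N/\lambda_2}+1},$$ and the corresponding optimal parameters are $$\alpha^*=\frac{4}{(\sqrt{\lambda_N}+\sqrt{\lambda_2})^2},\qquad \theta_0^*=\left(\frac{\sqrt{\lambda_N/\lambda_2}-1}{\sqrt{\lambda_N/\lambda_2}+1}\right)^2,\qquad \theta_1^*=-\theta_0^*.$$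
   Context: The graph is undirected with adjacency matrix $\mathcal A=[a_{ij}]$, $a_{ii}=0$, $a_{ij}=a_{ji}>0$ iff $i$ and $j$ are adjacent (and $a_{ij}=0$ otherwise). The Laplacian is $\mathcal L=\mathcal D-\mathcal A$ with $\mathcal D=\mathrm{diag}(d_1,\dots,d_N)$, $d_i=\sum_j a_{ij}$; its eigenvalues are $0=\lambda_1<\lambda_2\le\cdots\le\lambda_N$. ''Optimal parameters'' means parameters at which the minimum defining $\gamma_1^*$ is attained. *)

(* Defs.v *)
From mathcomp Require Import all_boot all_order all_algebra.
From mathcomp Require Import complex.
From mathcomp Require Import reals.

Set Implicit Arguments.
Unset Strict Implicit.
Unset Printing Implicit Defensive.

Import Order.TTheory GRing.Theory Num.Theory.

Local Open Scope ring_scope.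

Definition simple_graph (T : finType) (e : rel T) : Prop :=
  symmetric e /\ irreflexive e.

Definition connected_graph (T : finType) (e : rel T) : Prop :=
  forall i j : T, connect e i j.

Definition weighted_adjacency (R : realType) (N : nat) (e : rel 'I_N)
    (A : 'M[R]_N) : Prop :=
  [/\ forall i, A i i = 0,
      forall i j, A i j = A j i,
      forall i j, e i j -> 0 < A i j
    & forall i j, ~~ e i j -> A i j = 0].

Definition degree_matrix (R : realType) (N : nat) (A : 'M[R]_N) : 'M[R]_N :=
  diag_mx (\row_i \sum_j A i j).

Definition laplacian (R : realType) (N : nat) (A : 'M[R]_N) : 'M[R]_N :=
  degree_matrix A - A.

(* The Laplacian of an undirected graph is symmetric, so its spectrum is real
   and [eigenvalue], which ranges over R, sees all of it. *)
Definition smallest_nonzero_eigenvalue (R : realType) (N : nat) (L : 'M[R]_N)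
    (a : R) : Prop :=
  [/\ eigenvalue L a, a != 0
    & forall b, eigenvalue L b -> b != 0 -> a <= b].

Definition largest_nonzero_eigenvalue (R : realType) (N : nat) (L : 'M[R]_N)
    (a : R) : Prop :=
  [/\ eigenvalue L a, a != 0
    & forall b, eigenvalue L b -> b != 0 -> b <= a].

Definition complex_roots (R : realType) (h : {poly R}) : seq R[i] :=
  sval (closed_field_poly_normal (map_poly (real_complex R) h)).

(* [normc] is the R-valued modulus on R[i].  The default value 0 of the
   iterated maximum only shows up when [h] has no root, i.e. for constants. *)
Definition max_root_modulus (R : realType) (h : {poly R}) : R :=
  \big[Num.max/0]_(z <- complex_roots h) ComplexField.Normc.normc z.

Lemma mem_complex_roots (R : realType) (h : {poly R}) (z : R[i]) :
  h != 0 -> (z \in complex_roots h) = root (map_poly (real_complex R) h) z.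
Proof.
move=> h0; rewrite /complex_roots; case: closed_field_poly_normal => /= r ->.
by rewrite rootZ ?root_prod_XsubC // lead_coef_eq0 map_poly_eq0.
Qed.

Definition h1 (R : realType) (theta0 : R) : {poly R} := 'X - theta0%:P.

Definition hi (R : realType) (lambda alpha theta0 theta1 : R) : {poly R} :=
  'X^2 - (1 + theta0 - alpha * lambda) *: 'X - theta1%:P.

Definition convergence_rate (R : realType)
    (lambda2 lambdaN alpha theta0 theta1 : R) : R :=
  Num.max (max_root_modulus (h1 theta0))
    (Num.max (max_root_modulus (hi lambda2 alpha theta0 theta1))
             (max_root_modulus (hi lambdaN alpha theta0 theta1))).

Definition optimal_parameters (R : realType)
    (lambda2 lambdaN alpha theta0 theta1 : R) : Prop :=
  theta0 + theta1 = 0 /\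
  forall a t0 t1 : R, t0 + t1 = 0 ->
    convergence_rate lambda2 lambdaN alpha theta0 theta1
      <= convergence_rate lambda2 lambdaN a t0 t1.

(* [gamma] is an attained minimum, hence unique. *)
Definition optimal_convergence_rate (R : realType)
    (lambda2 lambdaN gamma : R) : Prop :=
  exists alpha theta0 theta1 : R,
    optimal_parameters lambda2 lambdaN alpha theta0 theta1 /\
    gamma = convergence_rate lambda2 lambdaN alpha theta0 theta1.

(* Main.v *)
(** If both roots of z^2 - b z + t lie in the disc of radius r, then |t| <= r^2
    and the polynomial is nonnegative at r and at -r.  For b = 1 + t - a l and
    r < 1 this gives (1 - r)^2 <= a l <= (1 + r)^2, where equality on the left
    forces t = r^2.  Applying the left bound to l = lambda2 and the right one to
    l = lambdaN and eliminating a yields sqrt (lambdaN / lambda2) <=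
    (1 + r) / (1 - r), that is gamma <= r; when r = gamma all these inequalities
    are equalities, which determines a and t.  Conversely, at these values the
    two quadratics are (z - gamma)^2 and (z + gamma)^2. *)

Require Import Defs.
From mathcomp Require Import all_boot all_order all_algebra.
From mathcomp Require Import complex.
From mathcomp Require Import reals.
From mathcomp Require Import ring lra.

Set Implicit Arguments.
Unset Strict Implicit.
Unset Printing Implicit Defensive.

Import Order.TTheory GRing.Theory Num.Theory.

Local Open Scope ring_scope.

Import ComplexField.Normc.

(** * Moduli of the complex roots of a real polynomial *)

Lemma normc_real (R : realType) (x : R) : normc (real_complex R x) = `|x|.
Proof. by rewrite /= expr0n /= addr0 sqrtr_sqr. Qed.

Lemma max_root_modulus_ge0 (R : realType) (h : {poly R}) :
  0 <= max_root_modulus h.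
Proof. by rewrite /max_root_modulus; exact: bigmax_ge_id. Qed.

Lemma max_root_modulus_le (R : realType) (h : {poly R}) (M : R) :
  h != 0 -> 0 <= M ->
  (forall z, root (map_poly (real_complex R) h) z -> normc z <= M) ->
  max_root_modulus h <= M.
Proof.
move=> h0 M0 hM; rewrite /max_root_modulus big_seq.
by apply: bigmax_le => // z; rewrite mem_complex_roots // => /hM.
Qed.

Lemma root_le_max_root_modulus (R : realType) (h : {poly R}) (x : R) :
  h != 0 -> root h x -> `|x| <= max_root_modulus h.
Proof.
move=> h0 hx; rewrite -normc_real /max_root_modulus.
apply: (le_bigmax_seq 0 (real_complex R x) xpredT (@normc R)) => //.
by rewrite mem_complex_roots // fmorph_root.
Qed.

(** Up to sign the constant coefficient is the product of the roots, counted with multiplicity. *)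
Lemma monic_coef0_le (R : realType) (h : {poly R}) :
  h \is monic -> `|h`_0| <= max_root_modulus h ^+ (size h).-1.
Proof.
move=> hmon.
have := svalP (closed_field_poly_normal (map_poly (real_complex R) h)).
rewrite -/(complex_roots h).
rewrite lead_coef_map (monicP hmon) rmorph1 scale1r => hE.
have szE : (size h).-1 = size (complex_roots h).
  by rewrite -(size_map_poly (real_complex R)) hE size_prod_XsubC.
have c0E : real_complex R h`_0 = \prod_(z <- complex_roots h) (0 - z).
  rewrite -coef_map [map_poly _ _]hE -horner_coef0 horner_prod.
  by apply: eq_bigr => z _; rewrite hornerXsubC.
rewrite -normc_real c0E szE (big_morph (@normc R) (@normcM R) (@normc1 R)).
(* The power becomes a constant product over the roots, so the two sides compare factor by
   factor. *)
rewrite -iter_mulr_1 -count_predT -big_const_seq big_seq [leRHS]big_seq.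
apply: ler_prod => z zin.
apply/andP; split; first by case: (0 - z) => a b /=; exact: sqrtr_ge0.
rewrite sub0r -mulN1r normcM -(rmorphN1 (real_complex R)) normc_real normrN1 mul1r.
exact: (le_bigmax_seq 0 z xpredT (@normc R)).
Qed.

(** * The quadratics [hi] and the constraints of a root bound *)

Lemma hi_quadratic (R : realType) (l a t0 t1 : R) :
  hi l a t0 t1 = 'X^2 + (- (1 + t0 - a * l)) *: 'X + (- t1)%:P.
Proof. by rewrite /hi scaleNr polyCN. Qed.

Lemma size_hi (R : realType) (l a t0 t1 : R) : size (hi l a t0 t1) = 3.
Proof.
rewrite hi_quadratic -addrA size_polyDl size_polyXn // ltnS.
rewrite (leq_trans (size_polyD _ _)) // geq_max.
rewrite (leq_trans (size_scale_leq _ _)) ?size_polyX //.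
exact: leq_trans (size_polyC_leq1 _) _.
Qed.

Lemma hi_monic (R : realType) (l a t0 t1 : R) : hi l a t0 t1 \is monic.
Proof.
rewrite monicE lead_coefE size_hi /hi !coefE /=.
by rewrite mulr0 !subr0.
Qed.

Lemma hi_neq0 (R : realType) (l a t0 t1 : R) : hi l a t0 t1 != 0.
Proof. exact/monic_neq0/hi_monic. Qed.

Lemma horner_hi (R : realType) (l a t0 t1 x : R) :
  (hi l a t0 t1).[x] = x ^+ 2 - (1 + t0 - a * l) * x - t1.
Proof. by rewrite /hi !hornerE. Qed.

Lemma hi_theta_le (R : realType) (l a t r : R) :
  max_root_modulus (hi l a t (- t)) <= r -> `|t| <= r ^+ 2.
Proof.
move=> hr; have := monic_coef0_le (hi_monic l a t (- t)).
rewrite size_hi /= /hi !coefE /= mulr0 subr0 sub0r opprK => /le_trans; apply.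
rewrite lerXn2r ?nnegrE ?max_root_modulus_ge0 //.
by rewrite (le_trans _ hr) ?max_root_modulus_ge0.
Qed.

Lemma quadratic_real_roots (R : realType) (b t x : R) :
  x ^+ 2 - b * x + t < 0 ->
  exists y z, [/\ y < x, x < z, y ^+ 2 - b * y + t = 0
                & z ^+ 2 - b * z + t = 0].
Proof.
move=> neg.
(* Completing the square: (2x - b)^2 equals four times the value at [x] plus the discriminant, so it
   lies below the discriminant. This also places [x] strictly between the roots. *)
have D0 : 0 <= b ^+ 2 - 4 * t by have := sqr_ge0 (2 * x - b); nra.
have [s s0 sE] : exists2 s, 0 <= s & s ^+ 2 = b ^+ 2 - 4 * t.
  by exists (Num.sqrt (b ^+ 2 - 4 * t)); rewrite ?sqrtr_ge0 ?sqr_sqrtr.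
have tE : t = (b ^+ 2 - s ^+ 2) / 4 by lra.
exists ((b - s) / 2), ((b + s) / 2); split; [nra | nra | |].
  by rewrite tE; field.
by rewrite tE; field.
Qed.

(** A negative value at [x] would put real roots strictly on both sides of [x]. As [x] is an
    endpoint of [-r, r], one of them would leave the disc. *)
Lemma hi_horner_ge0 (R : realType) (l a t r x : R) :
  max_root_modulus (hi l a t (- t)) <= r -> `|x| = r ->
  0 <= (hi l a t (- t)).[x].
Proof.
move=> hr xr; rewrite leNgt; apply/negP; rewrite horner_hi opprK.
move=> /quadratic_real_roots [y [z [yx xz hy hz]]].
have yr : `|y| <= r.
  apply: le_trans hr; apply: root_le_max_root_modulus (hi_neq0 _ _ _ _) _.
  by rewrite rootE horner_hi opprK hy.
have zr : `|z| <= r.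
  apply: le_trans hr; apply: root_le_max_root_modulus (hi_neq0 _ _ _ _) _.
  by rewrite rootE horner_hi opprK hz.
move: yr zr; rewrite !ler_norml => /andP[yr _] /andP[_ zr].
by have [x0|x0] := ger0P x; move: xr; rewrite ?(ger0_norm x0) ?(ltr0_norm x0); lra.
Qed.

Lemma hi_bounds (R : realType) (l a t r : R) :
  0 <= r -> r < 1 -> max_root_modulus (hi l a t (- t)) <= r ->
  [/\ (1 - r) ^+ 2 <= a * l, a * l <= (1 + r) ^+ 2
    & a * l = (1 - r) ^+ 2 -> t = r ^+ 2].
Proof.
move=> r0 r1 hr; have := hi_theta_le hr; rewrite ler_norml => /andP[tl tr].
have := hi_horner_ge0 hr (ger0_norm r0).
have := hi_horner_ge0 hr (etrans (normrN r) (ger0_norm r0)).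
rewrite !horner_hi !opprK => pN pP.
(* At r = 0 the values at r and -r carry no information on [a * l]. Here t = 0, and the root 1 - a l
   must itself vanish. *)
have [rE|rn0] := eqVneq r 0.
  subst r; have t0 : t = 0 by lra.
  have /le_trans/(_ hr) : `|1 + t - a * l| <= max_root_modulus (hi l a t (- t)).
    apply: root_le_max_root_modulus (hi_neq0 _ _ _ _) _.
    by rewrite rootE horner_hi t0; apply/eqP; ring.
  by rewrite t0 normr_le0 => /eqP hb; split; lra.
have rp : 0 < r by rewrite lt_def rn0.
(* The signs at r and at -r, solved for [r * (a * l)]; inserting |t| <= r^2 and cancelling r gives
   the two bounds. *)
have lo : (1 - r) * (r - t) <= r * (a * l) by lra.
have up : r * (a * l) <= (1 + r) * (r + t) by lra.
split.
- by rewrite -(ler_pM2l rp); apply: le_trans lo; nra.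
- by rewrite -(ler_pM2l rp); apply: (le_trans up); nra.
(* Now [lo] reads (1 - r)(r - t) <= r (1 - r)^2, and cancelling 1 - r leaves r^2 <= t. *)
- move=> alE; rewrite alE in lo; apply/le_anti; rewrite tr /=.
  have q0 : 0 < 1 - r by lra.
  rewrite -(ler_pM2l q0); lra.
Qed.

Lemma convergence_rate_ge0 (R : realType) (l2 lN a t0 t1 : R) :
  0 <= convergence_rate l2 lN a t0 t1.
Proof. by rewrite /convergence_rate le_max max_root_modulus_ge0. Qed.

Lemma max_root_modulus_hi_square (R : realType) (l a t0 t1 x : R) :
  hi l a t0 t1 = ('X - x%:P) ^+ 2 -> max_root_modulus (hi l a t0 t1) <= `|x|.
Proof.
move=> hE; apply: max_root_modulus_le (hi_neq0 _ _ _ _) (normr_ge0 _) _ => z.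
rewrite hE rmorphXn /= map_polyXsubC rootE horner_exp hornerXsubC.
by rewrite expf_eq0 /= subr_eq0 => /eqP ->; rewrite -normc_real.
Qed.

(** * Nonnegativity of the Laplacian spectrum *)

Section LaplacianSpectrum.

Variables (R : realType) (N : nat) (e : rel 'I_N) (A : 'M[R]_N).
Hypothesis wA : weighted_adjacency e A.

Lemma weighted_adjacency_ge0 i j : 0 <= A i j.
Proof.
case: wA => _ _ Apos Azero.
by case: (boolP (e i j)) => [/Apos/ltW | /Azero ->].
Qed.

Lemma laplacian_form (v : 'rV[R]_N) :
  2 * ((v *m laplacian A) *m v^T) 0 0 =
  \sum_i \sum_j A i j * (v 0 i - v 0 j) ^+ 2.
Proof.
case: wA => _ Asym _ _.
pose S := \sum_i \sum_j A i j * v 0 i ^+ 2.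
pose C := \sum_i \sum_j A i j * (v 0 i * v 0 j).
have formE : ((v *m laplacian A) *m v^T) 0 0 = S - C.
  rewrite /laplacian /degree_matrix mulmxBr mulmxBl !mxE; congr (_ - _).
    apply: eq_bigr => i _; rewrite mul_mx_diag !mxE mulrAC mulrC big_distrl /=.
    by apply: eq_bigr => j _; rewrite expr2.
  rewrite /C exchange_big /=; apply: eq_bigr => i _.
  by rewrite !mxE big_distrl /=; apply: eq_bigr => j _; ring.
have SE : S = \sum_i \sum_j A i j * v 0 j ^+ 2.
  rewrite /S exchange_big /=; apply: eq_bigr => i _.
  by apply: eq_bigr => j _; rewrite Asym.
have -> : 2 * ((v *m laplacian A) *m v^T) 0 0 = S + S - 2 * C.
  by rewrite formE; ring.
rewrite {2}SE /S /C mulr_sumr -big_split -sumrB; apply: eq_bigr => i _ /=.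
rewrite mulr_sumr -big_split -sumrB; apply: eq_bigr => j _ /=; ring.
Qed.

Lemma laplacian_eigenvalue_ge0 a : eigenvalue (laplacian A) a -> 0 <= a.
Proof.
case/eigenvalueP => v vL v0; have := laplacian_form v.
rewrite vL -scalemxAl mxE => formE.
have vv : 0 < (v *m v^T) 0 0.
  rewrite mxE lt_def sumr_ge0 ?andbT; last first.
    by move=> i _; rewrite !mxE -expr2 sqr_ge0.
  apply: contra_neq v0 => /eqP; rewrite psumr_eq0; last first.
    by move=> i _; rewrite !mxE -expr2 sqr_ge0.
  move=> /allP z; apply/rowP => i; have := z i (mem_index_enum _).
  by rewrite !mxE mulf_eq0 orbb => /eqP.
rewrite -(pmulr_lge0 _ vv) -(pmulr_rge0 _ (ltr0Sn R 1)) formE.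
by do 2!apply: sumr_ge0 => ? _; rewrite mulr_ge0 ?weighted_adjacency_ge0 ?sqr_ge0.
Qed.

End LaplacianSpectrum.

(** * The minimax problem in terms of the square roots of the eigenvalues *)

Section OptimalRate.

Variables (R : realType) (s2 sN : R).
Hypotheses (s2_gt0 : 0 < s2) (le_s2N : s2 <= sN).

(** The claimed rate, with numerator and denominator multiplied by [s2]. *)
Let gamma : R := (sN - s2) / (sN + s2).

Let sum_gt0 : 0 < sN + s2. Proof. by rewrite addr_gt0 // (lt_le_trans s2_gt0). Qed.
Let sum_neq0 : sN + s2 != 0. Proof. by rewrite gt_eqF. Qed.

Let gamma_ge0 : 0 <= gamma.
Proof. by rewrite divr_ge0 ?subr_ge0 // ltW. Qed.

Let gamma_lt1 : gamma < 1.
Proof. by rewrite ltr_pdivrMr //; move: s2_gt0; lra. Qed.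

Lemma convergence_rate_ge a t :
  gamma <= convergence_rate (s2 ^+ 2) (sN ^+ 2) a t (- t).
Proof.
have r0 := convergence_rate_ge0 (s2 ^+ 2) (sN ^+ 2) a t (- t).
set r := convergence_rate _ _ _ _ _ in r0 *.
have [r1|] := ltP r 1; last by move=> /(le_trans (ltW gamma_lt1)).
have m2 : max_root_modulus (hi (s2 ^+ 2) a t (- t)) <= r.
  by rewrite !le_max lexx !orbT.
have mN : max_root_modulus (hi (sN ^+ 2) a t (- t)) <= r.
  by rewrite !le_max lexx !orbT.
have [lo _ _] := hi_bounds r0 r1 m2.
have [_ up _] := hi_bounds r0 r1 mN.
(* Cross-multiplying the lower bound at [s2 ^+ 2] and the upper bound at [sN ^+ 2] eliminates [a].
   The square roots then give an inequality linear in r. *)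
have ratio : ((1 - r) * sN) ^+ 2 <= ((1 + r) * s2) ^+ 2.
  rewrite !exprMn.
  have : (1 - r) ^+ 2 * sN ^+ 2 <= a * s2 ^+ 2 * sN ^+ 2.
    by rewrite ler_pM2r // exprn_gt0 // (lt_le_trans s2_gt0).
  have : a * sN ^+ 2 * s2 ^+ 2 <= (1 + r) ^+ 2 * s2 ^+ 2.
    by rewrite ler_pM2r // exprn_gt0.
  lra.
have := ratio; rewrite ler_pXn2r ?nnegrE ?mulr_ge0 //; move: s2_gt0 le_s2N; try lra.
by rewrite ler_pdivrMr //; lra.
Qed.

Lemma convergence_rate_le_gamma a t :
  convergence_rate (s2 ^+ 2) (sN ^+ 2) a t (- t) <= gamma ->
  a = 4 / (sN + s2) ^+ 2 /\ t = gamma ^+ 2.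
Proof.
rewrite /convergence_rate !ge_max => /and3P[_ m2 mN].
have [lo _ teq] := hi_bounds gamma_ge0 gamma_lt1 m2.
have [_ up _] := hi_bounds gamma_ge0 gamma_lt1 mN.
(* Since 1 - gamma = 2 s2 / (sN + s2) and 1 + gamma = 2 sN / (sN + s2), the two bounds squeeze [a]
   to one value, and the equality case of the lower one fixes [t]. *)
have lE : (1 - gamma) ^+ 2 = 4 / (sN + s2) ^+ 2 * s2 ^+ 2 by rewrite /gamma; field.
have uE : (1 + gamma) ^+ 2 = 4 / (sN + s2) ^+ 2 * sN ^+ 2 by rewrite /gamma; field.
have l2_gt0 : 0 < s2 ^+ 2 by rewrite exprn_gt0.
have lN_gt0 : 0 < sN ^+ 2 by rewrite exprn_gt0 // (lt_le_trans s2_gt0).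
have aE : a = 4 / (sN + s2) ^+ 2.
  apply/le_anti; rewrite -(ler_pM2r lN_gt0) -uE up /=.
  by rewrite -(ler_pM2r l2_gt0) -lE lo.
by split=> //; apply: teq; rewrite aE lE.
Qed.

Lemma convergence_rate_optimal :
  convergence_rate (s2 ^+ 2) (sN ^+ 2)
    (4 / (sN + s2) ^+ 2) (gamma ^+ 2) (- gamma ^+ 2) = gamma.
Proof.
apply/le_anti; rewrite convergence_rate_ge andbT /convergence_rate !ge_max.
have -> /= : max_root_modulus (h1 (gamma ^+ 2)) <= gamma.
  apply: max_root_modulus_le => //; first exact/monic_neq0/monicXsubC.
  move=> z; rewrite map_polyXsubC root_XsubC => /eqP ->.
  by rewrite normc_real ger0_norm ?sqr_ge0 // expr2 ler_piMl // ltW.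
apply/andP; split.
  rewrite -{3}(ger0_norm gamma_ge0); apply: max_root_modulus_hi_square.
  (* The middle coefficient is 1 + gamma^2 - (1 - gamma)^2 = 2 gamma; at [sN ^+ 2] the sign of gamma
     flips. *)
  have -> : hi (s2 ^+ 2) (4 / (sN + s2) ^+ 2) (gamma ^+ 2) (- gamma ^+ 2) =
            'X^2 - (2 * gamma) *: 'X + (gamma ^+ 2)%:P.
    by rewrite /hi polyCN opprK; congr (_ - _ *: _ + _); rewrite /gamma; field.
  rewrite -mul_polyC !rmorphM rmorph_nat /=; ring.
rewrite -{3}(ger0_norm gamma_ge0) -[`|gamma|]normrN.
apply: max_root_modulus_hi_square.
have -> : hi (sN ^+ 2) (4 / (sN + s2) ^+ 2) (gamma ^+ 2) (- gamma ^+ 2) =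
          'X^2 - (- (2 * gamma)) *: 'X + (gamma ^+ 2)%:P.
  by rewrite /hi polyCN opprK; congr (_ - _ *: _ + _); rewrite /gamma; field.
rewrite -mul_polyC !rmorphN !rmorphM rmorph_nat /=; ring.
Qed.

End OptimalRate.

Theorem theorem3 (R : realType) (N : nat) (e : rel 'I_N) (A : 'M[R]_N)
    (lambda2 lambdaN : R) :
  (2 <= N)%N ->
  simple_graph e ->
  connected_graph e ->
  weighted_adjacency e A ->
  smallest_nonzero_eigenvalue (laplacian A) lambda2 ->
  largest_nonzero_eigenvalue (laplacian A) lambdaN ->
  let gamma := (Num.sqrt (lambdaN / lambda2) - 1)
               / (Num.sqrt (lambdaN / lambda2) + 1) in
  optimal_convergence_rate lambda2 lambdaN gamma /\
  (forall alpha theta0 theta1 : R,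
     optimal_parameters lambda2 lambdaN alpha theta0 theta1 <->
     [/\ alpha = 4 / (Num.sqrt lambdaN + Num.sqrt lambda2) ^+ 2,
         theta0 = gamma ^+ 2
       & theta1 = - theta0]).
Proof.
move=> _ _ _ wA [ev2 n2 _] [evN nN maxN] gamma.
have l2_gt0 : 0 < lambda2 by rewrite lt_def n2 (laplacian_eigenvalue_ge0 wA ev2).
have le_l2N := maxN _ ev2 n2.
have s2_gt0 : 0 < Num.sqrt lambda2 by rewrite sqrtr_gt0.
have le_s2N : Num.sqrt lambda2 <= Num.sqrt lambdaN by rewrite ler_wsqrtr.
have s2E : Num.sqrt lambda2 ^+ 2 = lambda2 by rewrite sqr_sqrtr ?ltW.
have sNE : Num.sqrt lambdaN ^+ 2 = lambdaN.
  by rewrite sqr_sqrtr // (le_trans (ltW l2_gt0)).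
have sNV : Num.sqrt (lambdaN / lambda2) = Num.sqrt lambdaN / Num.sqrt lambda2.
  by rewrite sqrtrM ?sqrtrV // ?(le_trans (ltW l2_gt0)) // ltW.
have gammaE : gamma = (Num.sqrt lambdaN - Num.sqrt lambda2) /
                      (Num.sqrt lambdaN + Num.sqrt lambda2).
  by rewrite /gamma sNV; field; rewrite !gt_eqF // addr_gt0 // (lt_le_trans s2_gt0).
(* Generalizing the square roots turns the eigenvalues into the squares [s2 ^+ 2] and [sN ^+ 2]. *)
move: (Num.sqrt lambda2) (Num.sqrt lambdaN) gamma s2_gt0 le_s2N s2E sNE gammaE.
move=> s2 sN gamma' s2_gt0 le_s2N <- <- ->.
have optE := convergence_rate_optimal s2_gt0 le_s2N.
have optP alpha theta0 theta1 :
    optimal_parameters (s2 ^+ 2) (sN ^+ 2) alpha theta0 theta1 <->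
    [/\ alpha = 4 / (sN + s2) ^+ 2,
        theta0 = ((sN - s2) / (sN + s2)) ^+ 2 & theta1 = - theta0].
  split=> [[/eqP] | [-> -> ->]].
    rewrite addrC addr_eq0 => /eqP -> opt.
    (* Comparison with the explicit candidate bounds the rate by gamma, where the parameters are
       unique. *)
    have := opt _ _ _ (subrr (((sN - s2) / (sN + s2)) ^+ 2)).
    move=> /(_ (4 / (sN + s2) ^+ 2)); rewrite optE.
    by move=> /(convergence_rate_le_gamma s2_gt0 le_s2N) [-> ->].
  split=> [|a t0 t1 /eqP]; first by rewrite subrr.
  rewrite addrC addr_eq0 => /eqP ->; rewrite optE.
  exact: convergence_rate_ge.
split=> //; exists (4 / (sN + s2) ^+ 2), (((sN - s2) / (sN + s2)) ^+ 2).
exists (- ((sN - s2) / (sN + s2)) ^+ 2); split; first exact/optP.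
by rewrite optE.
Qed.
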